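(* Let $\mathbf u$ be a sequence of transpositions in $\mathrm{Sym}(3)$ such that the union of the supports of its terms is $\{0,1,2\}$. Then $\mathbf u$ is conjugacy invariant if and only if either $|\mathbf u|$ is odd or $\mathcal T(\mathbf u)$ is a multitree with at least one simple multiedge.
   Context: Permutations compose left to right. For a finite sequence $\mathbf s$ in $\mathrm{Sym}(3)$, $|\mathbf s|$ is its length, $\bigcirc\mathbf s$ the composite of its terms in order, $\mathrm{Seq}(\mathbf s)$ its set of rearrangements and $\mathrm{Prod}(\mathbf s)=\{\bigcirc\mathbf r:\mathbf r\in\mathrm{Seq}(\mathbf s)\}$; $\mathbf s$ is conjugacy invariant iff every element of $\mathrm{Prod}(\mathbf s)$ is conjugate to $\bigcirc\mathbf s$. $\mathcal T(\mathbf u)$ is the multigraph on vertex set $\{0,1,2\}$ in which the multiedge $(x\,y)$ has multiplicity equal to the number of terms of $\mathbf u$ equal to $(x\,y)$; a multiedge is simple if its multiplicity is $1$; a multitree is a multigraph whose underlying simple graph is a tree. *)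

(* Defs.v *)
From HB Require Import structures.
From mathcomp Require Import all_boot all_fingroup.

Set Implicit Arguments.
Unset Strict Implicit.
Unset Printing Implicit Defensive.

Section SequencesOfPermutations.

Variable T : finType.
Implicit Types (p : {perm T}) (s u : seq {perm T}).

(* The product of {perm T} is left-to-right composition: (p * q) x = q (p x). *)
Definition composite s : {perm T} := (\prod_(p <- s) p)%g.

Definition rearrangements s : seq (seq {perm T}) := permutations s.

Definition Prod s : {set {perm T}} :=
  [set:: [seq composite r | r <- rearrangements s]].

Definition conjugacy_invariant s : Prop :=
  forall p, p \in Prod s -> p \in (composite s ^: [set: {perm T}])%g.

Definition transposition p : Prop := exists x y : T, x != y /\ p = tperm x y.

Definition psupport p : {set T} := [set x | p x != x].

End SequencesOfPermutations.

(* A loopless multigraph on T, given by the multiplicity of each pair {x, y};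
   multiplicity 0 means that there is no multiedge between x and y. *)
Record multigraph (T : finType) := Multigraph {
  multiplicity : T -> T -> nat;
  multiplicity_sym : forall x y, multiplicity x y = multiplicity y x;
  multiplicity_loop : forall x, multiplicity x x = 0
}.

Section Multigraphs.

Variable T : finType.
Implicit Types (e : rel T) (G : multigraph T).

Definition underlying_graph G : rel T := fun x y => 0 < multiplicity G x y.

Definition connected_graph e : Prop :=
  0 < #|T| /\ forall x y : T, connect e x y.

(* The bound on the size excludes the closed walks x - y - x along one edge,
   which ucycle accepts for a symmetric relation. *)
Definition acyclic_graph e : Prop :=
  forall c : seq T, 2 < size c -> ~ ucycle e c.

Definition tree e : Prop := connected_graph e /\ acyclic_graph e.

Definition multitree G : Prop := tree (underlying_graph G).

Definition has_simple_multiedge G : Prop :=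
  exists x y : T, multiplicity G x y = 1.

End Multigraphs.

Section TranspositionMultigraph.

Variables (T : finType) (u : seq {perm T}).

(* The diagonal is cut off because tperm x x is the identity. *)
Definition transp_mult (x y : T) : nat :=
  if x == y then 0 else count_mem (tperm x y) u.

Lemma transp_mult_sym x y : transp_mult x y = transp_mult y x.
Proof. by rewrite /transp_mult eq_sym tpermC. Qed.

Lemma transp_mult_loop x : transp_mult x x = 0.
Proof. by rewrite /transp_mult eqxx. Qed.

Definition transp_multigraph : multigraph T :=
  Multigraph transp_mult_sym transp_mult_loop.

End TranspositionMultigraph.

(* Main.v *)
(** In [Sym(3)] two permutations of the same sign are conjugate unless exactly
    one of them is the identity.  Hence [u] is conjugacy invariant iff [Prod u]
    is [{1}] or omits [1], which is automatic when [|u|] is odd.  Write [a], [b],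
    [c] for the three transpositions.  Cancelling equal adjacent letters shows
    that a word [w] whose multiplicities are bounded by, and of the same parity
    as, those of [u] has its composite in [Prod u].  For [|u|] even, the words
    [ab] and [acbc = 1] exclude the parities (odd, odd, even > 0); if [a] and [b]
    both occur at least twice, [1] and [abab], or [ab] and [(ab)^3 = 1], finish
    the remaining cases. *)
Require Import Defs.
From mathcomp Require Import all_boot all_fingroup.
From mathcomp Require Import zify.

(** * Distinct points and transpositions on three points *)

Lemma mem_full_uniq {T : finType} {s : seq T} (t : T) :
  uniq s -> #|T| <= size s -> t \in s.
Proof.
move=> U sT; have sub : {subset s <= enum T} by move=> q; rewrite mem_enum.
rewrite cardE in sT.
by rewrite (uniq_min_size U sub sT).2 mem_enum.
Qed.

Lemma mem_uniq3 {x y z : 'I_3} (t : 'I_3) :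
  uniq [:: x; y; z] -> [|| t == x, t == y | t == z].
Proof. by move=> U; have := mem_full_uniq t U; rewrite !inE card_ord => ->. Qed.

Lemma third_point {x y : 'I_3} : x != y -> exists z, uniq [:: x; y; z].
Proof.
move=> xy; suff [z] : exists z, z \notin [:: x; y].
  by rewrite !inE !negb_or => /andP[zx zy]; exists z; rewrite /= !inE
    negb_or xy (eq_sym x) (eq_sym y) zx zy.
apply/existsP; rewrite -negb_forall; apply/forallP => H.
have /uniq_leq_size : {subset enum 'I_3 <= [:: x; y]} by move=> t _; apply: H.
by rewrite enum_uniq size_enum_ord => /(_ isT).
Qed.

Lemma uniq3P {T : eqType} {x y z : T} :
  uniq [:: x; y; z] -> [/\ x != y, y != z & x != z].
Proof. by rewrite /= !inE negb_or andbT => /andP[/andP[-> ->] ->]. Qed.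

Lemma uniq3_rot {T : eqType} {x y z : T} :
  uniq [:: x; y; z] -> uniq [:: y; z; x].
Proof. by move=> U; rewrite -(rot_uniq 1) in U. Qed.

Lemma uniq3_swap {T : eqType} {x y z : T} :
  uniq [:: x; y; z] -> uniq [:: y; x; z].
Proof. by case/uniq3P=> xy yz xz; rewrite /= !inE negb_or eq_sym xy yz xz. Qed.

Lemma transposition3P {x y z : 'I_3} (p : 'S_3) : uniq [:: x; y; z] ->
  transposition p -> [|| p == tperm x y, p == tperm y z | p == tperm x z].
Proof.
move=> U [s [t [st ->]]].
move: (mem_uniq3 s U) (mem_uniq3 t U) st.
by case/or3P=> /eqP->; case/or3P=> /eqP->; rewrite ?eqxx //;
   rewrite ?(tpermC y x) ?(tpermC z y) ?(tpermC z x) ?eqxx ?orbT.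
Qed.

Lemma tperm3_uniq {x y z : 'I_3} : uniq [:: x; y; z] ->
  uniq [:: tperm x y; tperm y z; tperm x z].
Proof.
case/uniq3P=> xy yz xz; rewrite /= !inE negb_or andbT -!andbA.
apply/and3P; split; apply/eqP => /permP.
- by move=> /(_ x); rewrite tpermL tpermD 1?eq_sym // => /eqP; rewrite eq_sym (negPf xy).
- by move=> /(_ x); rewrite !tpermL => /eqP; rewrite (negPf yz).
- by move=> /(_ y); rewrite tpermL (tpermD xy) 1?eq_sym // => /eqP;
  rewrite eq_sym (negPf yz).
Qed.

Lemma tperm3_neqE {x y z : 'I_3} : uniq [:: x; y; z] ->
  ((tperm x y == tperm y z) = false) * ((tperm y z == tperm x z) = false) *
  ((tperm x y == tperm x z) = false) * ((tperm y z == tperm x y) = false) *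
  ((tperm x z == tperm y z) = false) * ((tperm x z == tperm x y) = false).
Proof.
move=> U; have [ab bc ac] := uniq3P (tperm3_uniq U).
by rewrite !(eq_sym (tperm x z)) (eq_sym (tperm y z) (tperm x y))
  (negPf ab) (negPf bc) (negPf ac).
Qed.

(** [tperm x y] is its own inverse, so the product is a conjugate of [tperm y z], with [y]
    relabelled as [x]. *)
Lemma tperm3_conj {x y z : 'I_3} : uniq [:: x; y; z] ->
  (tperm x y * tperm y z * tperm x y)%g = tperm x z.
Proof.
case/uniq3P=> xy yz xz.
by rewrite -{1}(tpermV x y) -mulgA -/(conjg _ _) tpermJ tpermR tpermD.
Qed.

(** * Elements and conjugacy classes of Sym(3) *)

Lemma tperm_mul_eq1 (T : finType) (s t : T) (p : {perm T}) :
  (tperm s t * p == 1)%g = (tperm s t == p).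
Proof. by rewrite -eq_invg_mul tpermV. Qed.

(** The six entries are pairwise distinct and Sym(3) has order 6. *)
Lemma S3_enum {x y z : 'I_3} (p : 'S_3) : uniq [:: x; y; z] ->
  p \in [:: 1; tperm x y; tperm y z; tperm x z;
            tperm x y * tperm y z; tperm y z * tperm x y]%g.
Proof.
move=> U; set l := [:: _; _; _; _; _; _].
have [ab bc ac] := uniq3P (tperm3_uniq U).
have [xy yz xz] := uniq3P U.
have Ul : uniq l.
  (* The sign separates the even entries from the odd ones. *)
  have D (q r : 'S_3) : (q : bool) != r -> q != r by apply: contraNneq => ->.
  have ab1 : (tperm x y * tperm y z != 1)%g by rewrite tperm_mul_eq1.
  have ba1 : (tperm y z * tperm x y != 1)%g by rewrite tperm_mul_eq1 eq_sym.
  (* Multiplying on the right by [tperm x y] turns the two sides into [tperm x z] and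
     [tperm y z]. *)
  have abba : (tperm x y * tperm y z != tperm y z * tperm x y)%g.
    by rewrite -(can_eq (mulgK (tperm x y))) (tperm3_conj U) -mulgA tperm2 mulg1 eq_sym.
  rewrite /= !inE !negb_or ab bc ac abba -!(eq_sym (_ * _)%g 1%g) ab1 ba1.
  by rewrite !D ?odd_permM ?odd_tperm ?odd_perm1 ?xy ?yz ?xz.
by apply: mem_full_uniq; rewrite ?card_Sn.
Qed.

(** A nontrivial even element of [Sym(3)] is a 3-cycle, and a transposition
    conjugates it to its inverse. *)
Lemma S3_conjugate (p q : 'S_3) :
  (p : bool) = q -> (p == 1%g) = (q == 1%g) -> p \in (q ^: [set: 'S_3])%g.
Proof.
pose x := @Ordinal 3 0 isT; pose y := @Ordinal 3 1 isT; pose z := @Ordinal 3 2 isT.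
have U : uniq [:: x; y; z] by [].
(* [rep r] depends only on the sign of [r] and on whether [r] is 1, so it suffices to conjugate each
   [r] to [rep r]. *)
pose rep (r : 'S_3) : 'S_3 :=
  if r == 1%g then 1%g else if r then tperm x y else (tperm x y * tperm y z)%g.
suff repP (r : 'S_3) : r \in (rep r ^: [set: 'S_3])%g.
  by move=> pq p1; rewrite (class_eqP (repP q)) /rep -pq -p1; apply: repP.
have J (s t : 'S_3) : (s ^ t)%g \in (s ^: [set: 'S_3])%g by rewrite memJ_class ?inE.
rewrite /rep; have [-> | r1] := eqVneq r 1%g; first by rewrite class_refl.
have := S3_enum r U; rewrite !inE (negPf r1) /=.
case/or4P=> [/eqP->|/eqP->|/eqP->|/orP[/eqP->|/eqP->]];
  rewrite ?odd_permM ?odd_tperm /= ?class_refl //.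
- by have := J (tperm x y) (tperm x z); rewrite tpermJ tpermL tpermD // tpermC.
- by have := J (tperm x y) (tperm y z); rewrite tpermJ tpermL tpermD.
- by have := J (tperm x y * tperm y z)%g (tperm x y);
  rewrite /conjg tpermV -mulgA tpermKg.
Qed.

(** * Composites, their signs and [Prod] *)

Lemma mem_ProdP {T : finType} {u : seq {perm T}} {p : {perm T}} :
  reflect (exists2 r, perm_eq r u & p = composite r) (p \in Prod u).
Proof.
rewrite /Prod inE; apply: (iffP mapP) => -[r ru ->]; exists r => //.
  by rewrite -mem_permutations.
by rewrite /rearrangements mem_permutations.
Qed.

Lemma composite_cat (T : finType) (r s : seq {perm T}) :
  composite (r ++ s) = (composite r * composite s)%g.
Proof. exact: big_cat. Qed.

Lemma composite_cons (T : finType) (p : {perm T}) (s : seq {perm T}) :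
  composite (p :: s) = (p * composite s)%g.
Proof. exact: big_cons. Qed.

Lemma composite_nil (T : finType) : composite [::] = 1%g :> {perm T}.
Proof. exact: big_nil. Qed.

Lemma composite_nseq (T : finType) (n : nat) (s t : T) :
  composite (nseq n (tperm s t)) = if odd n then tperm s t else 1%g.
Proof.
elim: n => [|n IHn]; first exact: composite_nil.
rewrite [nseq _ _]/= composite_cons IHn /=.
by case: odd; rewrite /= ?tperm2 ?mulg1.
Qed.

Lemma odd_composite (T : finType) (u : seq {perm T}) :
  (forall p, p \in u -> transposition p) -> (composite u : bool) = odd (size u).
Proof.
elim: u => [|p u IHu] tu; first by rewrite composite_nil odd_perm1.
rewrite composite_cons odd_permM IHu; last by move=> q qu; apply: tu; rewrite inE qu orbT.
by have [s [t [st ->]]] := tu p (mem_head _ _); rewrite odd_tperm st.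
Qed.

Lemma odd_Prod (T : finType) (u : seq {perm T}) (p : {perm T}) :
  (forall q, q \in u -> transposition q) -> p \in Prod u ->
  (p : bool) = odd (size u).
Proof.
move=> tu /mem_ProdP[r ru ->]; rewrite odd_composite ?(perm_size ru) // => q.
by rewrite (perm_mem ru); apply: tu.
Qed.

Lemma composite_in_Prod (T : finType) (u : seq {perm T}) : composite u \in Prod u.
Proof. by apply/mem_ProdP; exists u. Qed.

(** The class of 1 is a singleton: this forces [composite u] to be 1, and then every product. *)
Lemma conjugacy_invariant1 (T : finType) (u : seq {perm T}) (p : {perm T}) :
  conjugacy_invariant u -> 1%g \in Prod u -> p \in Prod u -> p = 1%g.
Proof.
move=> inv /inv; rewrite class_sym class1G inE => /eqP u1 /inv.
by rewrite u1 class1G inE => /eqP.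
Qed.

(** * Multiplicities and word reduction *)

Definition mult3 (u : seq 'S_3) (s t : 'I_3) : nat := count_mem (tperm s t) u.

Lemma mult3C (u : seq 'S_3) (s t : 'I_3) : mult3 u s t = mult3 u t s.
Proof. by rewrite /mult3 tpermC. Qed.

Lemma mult3_nil (s t : 'I_3) : mult3 [::] s t = 0.
Proof. by []. Qed.

Lemma mult3_cons (p : 'S_3) (u : seq 'S_3) (s t : 'I_3) :
  mult3 (p :: u) s t = (p == tperm s t) + mult3 u s t.
Proof. by []. Qed.

Lemma size_mult3 {x y z : 'I_3} {u : seq 'S_3} : uniq [:: x; y; z] ->
  (forall p, p \in u -> transposition p) ->
  size u = mult3 u x y + mult3 u y z + mult3 u x z.
Proof.
move=> U; elim: u => [|p u IHu] tu //.
rewrite [size _]/= IHu; last by move=> q qu; apply: tu; rewrite inE qu orbT.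
rewrite !mult3_cons; have := transposition3P p U (tu p (mem_head _ _)).
by case/or3P=> /eqP->; rewrite ?eqxx ?(tperm3_neqE U) /=; lia.
Qed.

(** Adding pairs of an involution, which cancel, can bring [m] copies up to [n]. *)
Definition pads_to (m n : nat) : bool := (m <= n) && (odd m == odd n).

(** The letters of [u] left over by [w] occur in pairs, which cancel when they
    are placed next to each other at the end. *)
Lemma reduced_word_in_Prod {x y z : 'I_3} {u : seq 'S_3} (w : seq 'S_3) :
  uniq [:: x; y; z] ->
  (forall p, p \in u -> transposition p) ->
  {subset w <= [:: tperm x y; tperm y z; tperm x z]} ->
  pads_to (mult3 w x y) (mult3 u x y) -> pads_to (mult3 w y z) (mult3 u y z) ->
  pads_to (mult3 w x z) (mult3 u x z) ->
  composite w \in Prod u.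
Proof.
move=> U tu sw /andP[la /eqP oa] /andP[lb /eqP ob] /andP[lc /eqP oc].
pose d s t := mult3 u s t - mult3 w s t.
apply/mem_ProdP; exists (w ++ nseq (d x y) (tperm x y)
  ++ nseq (d y z) (tperm y z) ++ nseq (d x z) (tperm x z)); last first.
  by rewrite !composite_cat !composite_nseq !oddB // oa ob oc !addbb !mulg1.
(* Counting each [p] shows this is a rearrangement: any [p] other than the three transpositions
   occurs in neither list. *)
apply/allP => p _ /=; rewrite !count_cat !count_nseq /=; apply/eqP.
have [|pl] := boolP (p \in [:: tperm x y; tperm y z; tperm x z]).
  rewrite !inE; case/or3P=> /eqP ->; rewrite ?eqxx ?(tperm3_neqE U) -?/(mult3 _ _ _);
  by rewrite !mul0n !mul1n /d ?addn0 ?add0n subnKC.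
have pw : p \notin w by apply: contra pl => /sw.
have pu : p \notin u.
  by apply: contra pl => /tu /(transposition3P p U); rewrite !inE.
move: pl; rewrite !inE !negb_or => /and3P[p1 p2 p3].
by rewrite (count_memPn pw) (count_memPn pu) !(eq_sym _ p)
  (negPf p1) (negPf p2) (negPf p3).
Qed.

(** * Sequences of even length *)

Ltac solve_reduced_word U :=
  first
  [ by move=> p; rewrite !inE; do ?[case/orP=> [/eqP->|]];
    try move=> /eqP->; rewrite ?eqxx ?orbT
  | by rewrite !mult3_cons mult3_nil ?eqxx ?(tperm3_neqE U) /pads_to; lia
  | by rewrite mult3_nil /pads_to; lia ].

(** Let [a], [b], [c] be [tperm x y], [tperm y z], [tperm x z]. As [c] occurs at least twice, both
    [ab] and [acbc] are available; [cbc = a] makes the second trivial, while [ab] is not. *)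
Lemma not_invariant_odd_odd_even (x y z : 'I_3) (u : seq 'S_3) :
  uniq [:: x; y; z] ->
  (forall p, p \in u -> transposition p) ->
  odd (mult3 u x y) -> odd (mult3 u y z) ->
  ~~ odd (mult3 u x z) -> 0 < mult3 u x z ->
  ~ conjugacy_invariant u.
Proof.
move=> U tu oa ob ec c0 inv; have [ab bc ac] := uniq3P (tperm3_uniq U).
have [a0 b0] := (odd_gt0 oa, odd_gt0 ob).
have c2 : 1 < mult3 u x z by case: (mult3 u x z) ec c0 => [|[]].
have Uzy := uniq3_rot (uniq3_rot (uniq3_swap (uniq3_rot U))).
have w1 : composite [:: tperm x y; tperm y z] \in Prod u.
  by apply: (reduced_word_in_Prod _ U tu); solve_reduced_word U.
have w2 : composite [:: tperm x y; tperm x z; tperm y z; tperm x z] \in Prod u.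
  by apply: (reduced_word_in_Prod _ U tu); solve_reduced_word U.
have w2E : composite [:: tperm x y; tperm x z; tperm y z; tperm x z] = 1%g.
  rewrite !composite_cons composite_nil mulg1 (mulgA (tperm x z)).
  by rewrite {1}(tpermC y z) (tperm3_conj Uzy) tperm2.
rewrite w2E in w2; have := conjugacy_invariant1 _ _ _ inv w2 w1.
rewrite !composite_cons composite_nil mulg1 => /eqP.
by rewrite tperm_mul_eq1 (negPf ab).
Qed.

(** Even length leaves four parity patterns: all three multiplicities even, or exactly one even. *)
Lemma not_invariant_two_multiple (x y z : 'I_3) (u : seq 'S_3) :
  uniq [:: x; y; z] ->
  (forall p, p \in u -> transposition p) -> ~~ odd (size u) ->
  1 < mult3 u x y -> 1 < mult3 u y z ->
  ~ conjugacy_invariant u.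
Proof.
move=> U tu; rewrite (size_mult3 U tu) !oddD => par a2 b2 inv.
have [ab bc ac] := uniq3P (tperm3_uniq U).
have aba := tperm3_conj U.
have bab : (tperm y z * tperm x y * tperm y z)%g = tperm x z.
  have := tperm3_conj (uniq3_swap (uniq3_rot U)).
  by rewrite (tpermC z y) (tpermC y x) (tpermC z x).
case oa: (odd (mult3 u x y)) par => par;
  case ob: (odd (mult3 u y z)) par => par;
  case oc: (odd (mult3 u x z)) par => // par.
(* The third multiplicity may be 0 here, so only [a] and [b] can be used; [(ab)^3] takes three of
   each. *)
- have odd_ge3 n : odd n -> 1 < n -> 2 < n by case: n => [|[|[]]].
  have [a3 b3] := (odd_ge3 _ oa a2, odd_ge3 _ ob b2).
  have w1 : composite [:: tperm x y; tperm y z] \in Prod u.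
    by apply: (reduced_word_in_Prod _ U tu); solve_reduced_word U.
  have w2 : composite [:: tperm x y; tperm y z; tperm x y;
                          tperm y z; tperm x y; tperm y z] \in Prod u.
    by apply: (reduced_word_in_Prod _ U tu); solve_reduced_word U.
  move: w1 w2; rewrite !composite_cons composite_nil mulg1 => w1.
  (* [(ab)^3] is grouped as [(aba)(bab)], and both factors equal [tperm x z]. *)
  rewrite !mulgA aba -!mulgA (mulgA (tperm y z)) bab tperm2 => w2.
  have/eqP := conjugacy_invariant1 _ _ _ inv w2 w1.
  by rewrite tperm_mul_eq1 (negPf ab).
(* The even multiplicity is now that of [tperm y z], positive by [b2]; in the next case it is that
   of [tperm x y]. *)
- apply: not_invariant_odd_odd_even inv; first exact: (uniq3_swap U);
  rewrite // 1?(mult3C u y x) ?oa ?ob ?oc //; lia.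
- apply: not_invariant_odd_odd_even inv; first exact: (uniq3_rot U);
  rewrite // 1?(mult3C u z x) 1?(mult3C u y x) ?oa ?ob ?oc //; lia.
- have w1 : composite [:: tperm x y; tperm y z; tperm x y; tperm y z] \in Prod u.
    by apply: (reduced_word_in_Prod _ U tu); solve_reduced_word U.
  have w2 : composite [::] \in Prod u.
    by apply: (reduced_word_in_Prod _ U tu); solve_reduced_word U.
  move: w1 w2; rewrite !composite_cons composite_nil mulg1 !mulgA aba => w1 w2.
  have/eqP := conjugacy_invariant1 _ _ _ inv w2 w1.
  by rewrite tperm_mul_eq1 eq_sym (negPf bc).
Qed.

(** With a single letter [tperm x y] among [n] letters [b := tperm y z], [n] odd,
    a trivial product would force [tperm x y = b ^+ n = b]. *)
Lemma one_notin_Prod (x y z : 'I_3) (u : seq 'S_3) :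
  uniq [:: x; y; z] ->
  (forall p, p \in u -> transposition p) -> ~~ odd (size u) ->
  mult3 u x y = 1 -> mult3 u x z = 0 ->
  1%g \notin Prod u.
Proof.
move=> U tu; have [ab bc ac] := uniq3P (tperm3_uniq U) => ev a1 c0.
apply/negP => /mem_ProdP[r ru r1].
have cr s t : mult3 r s t = mult3 u s t by rewrite /mult3 (seq.permP ru).
have ar : tperm x y \in r by rewrite -has_pred1 has_count -/(mult3 r x y) cr a1.
have rP p : p \in r -> (p == tperm x y) || (p == tperm y z).
  move=> pr; have := transposition3P p U (tu p _); rewrite -(perm_mem ru) => /(_ pr).
  case/or3P=> /eqP pE; rewrite pE ?eqxx ?orbT //.
  have : 0 < mult3 r x z by rewrite /mult3 -has_count has_pred1 -pE.
  by rewrite cr c0.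
have {ru} sr : ~~ odd (size r) by rewrite (perm_size ru).
(* Cut [r] at its only [tperm x y]; both sides then consist of copies of [tperm y z]. *)
move: a1 sr r1 rP; rewrite -cr /mult3; case/splitPr: ar => s t.
rewrite count_cat /= eqxx size_cat /= => a1 sr r1 rP.
move/eqP: a1; rewrite addnCA eqSS addn_eq0 =>
  /andP[/eqP/count_memPn sa /eqP/count_memPn ta].
have sE : all (pred1 (tperm y z)) s.
  apply/allP => p ps /=; have := rP p; rewrite mem_cat ps => /(_ isT)/orP[]// /eqP pE.
  by rewrite pE (negPf sa) in ps.
have tE : all (pred1 (tperm y z)) t.
  apply/allP => p ps /=; have := rP p; rewrite mem_cat inE ps !orbT =>
    /(_ isT)/orP[]// /eqP pE.
  by rewrite pE (negPf ta) in ps.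
move: r1; rewrite composite_cat composite_cons.
move/all_pred1P: sE => ->; move/all_pred1P: tE => ->; rewrite !composite_nseq.
(* The two lengths have odd sum, so one side composes to [tperm y z] and the other to 1. *)
move: sr; rewrite addnS /= negbK oddD.
case: (odd (size s)); case: (odd (size t)) => // _ /esym/eqP.
  by rewrite mulg1 tperm_mul_eq1 eq_sym (negPf ab).
by rewrite mul1g tperm_mul_eq1 (negPf ab).
Qed.

(** * Multitrees on three vertices and the support condition *)

(** Every vertex is joined to the centre [y]. A 3-cycle would use the missing edge, and a longer one
    would need a fourth vertex. *)
Lemma multitree_path (x y z : 'I_3) (G : multigraph 'I_3) :
  uniq [:: x; y; z] ->
  0 < multiplicity G x y -> 0 < multiplicity G y z -> multiplicity G x z = 0 ->
  multitree G.
Proof.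
move=> U xy yz xz; rewrite /multitree; set e := underlying_graph G.
have es : symmetric e by move=> s t; rewrite /e /underlying_graph multiplicity_sym.
have exy : e x y by []. have eyz : e y z by [].
have exz : e x z = false by rewrite /e /underlying_graph xz.
have ezx : e z x = false by rewrite es.
split; first split; first by rewrite card_ord.
- have cy t : connect e y t.
    case/or3P: (mem_uniq3 t U) => /eqP->; rewrite ?connect0 ?connect1 //.
    by rewrite es.
  by move=> s t; apply: connect_trans (cy t); rewrite (sym_connect_sym es).
- case=> [|a [|b [|d [|d' c]]]] // _ /andP[].
    rewrite /= andbT => /and3P[eab ebd eda] /uniq3P[nab nbd nad].
    move: eab ebd eda nab nbd nad.
    case/or3P: (mem_uniq3 a U) => /eqP->; case/or3P: (mem_uniq3 b U) => /eqP->;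
    case/or3P: (mem_uniq3 d U) => /eqP->; by rewrite ?eqxx ?exz ?ezx /=.
  by move=> _ /card_uniqP; have := max_card (mem [:: a, b, d, d' & c]);
    rewrite card_ord => + E; rewrite E.
Qed.

Lemma multitree_not_triangle (x y z : 'I_3) (G : multigraph 'I_3) :
  uniq [:: x; y; z] -> multitree G ->
  0 < multiplicity G x y -> 0 < multiplicity G y z -> multiplicity G x z = 0.
Proof.
move=> U [_ acyc] xy yz; apply/eqP; rewrite -leqn0 leqNgt; apply/negP => xz.
apply: (acyc [:: x; y; z]) => //; apply/andP; split=> //.
by rewrite /= andbT /underlying_graph xy yz multiplicity_sym xz.
Qed.

Lemma transp_mult3 (u : seq 'S_3) (s t : 'I_3) :
  s != t -> multiplicity (transp_multigraph u) s t = mult3 u s t.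
Proof. by move=> st; rewrite /= /transp_mult (negPf st). Qed.

(** Otherwise every term is [tperm x z], and [y] lies in no support. *)
Lemma mult3_support (x y z : 'I_3) (u : seq 'S_3) :
  uniq [:: x; y; z] ->
  (forall p, p \in u -> transposition p) ->
  \bigcup_(p <- u) psupport p = [set: 'I_3] ->
  0 < mult3 u x y + mult3 u y z.
Proof.
move=> U tu su; rewrite lt0n; apply/negP; rewrite addn_eq0 => /andP[/eqP a0 /eqP b0].
have [xy yz xz] := uniq3P U.
have yfix p : p \in u -> p y = y.
  move=> pu; have m s t : mult3 u s t = 0 -> p != tperm s t.
    by move/count_memPn; apply: contraNneq => <-.
  have := transposition3P p U (tu p pu).
  by rewrite (negPf (m _ _ a0)) (negPf (m _ _ b0)) => /eqP->; rewrite tpermD // eq_sym.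
have : y \in \bigcup_(p <- u) psupport p by rewrite su inE.
rewrite big_seq; apply/negP; elim/big_ind: _ => [|A B|p pu]; rewrite !inE //.
  by rewrite negb_or => -> ->.
by rewrite yfix ?eqxx.
Qed.

Theorem theorem3p5 (u : seq 'S_3)
  (u_transp : forall p : 'S_3, p \in u -> transposition p)
  (u_supp : \bigcup_(p <- u) psupport p = [set: 'I_3]) :
  conjugacy_invariant u <->
  (odd (size u) \/
   (multitree (transp_multigraph u) /\
    has_simple_multiedge (transp_multigraph u))).
Proof.
(* All products have the same sign. In either case none is 1, so [S3_conjugate] applies. *)
have invI : (odd (size u) \/ 1%g \notin Prod u) -> conjugacy_invariant u.
  have cu := composite_in_Prod _ u.
  move=> H p pu; apply: S3_conjugate; first by rewrite !(odd_Prod _ u).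
  have neq1 q : q \in Prod u -> (q == 1%g) = false.
    move=> qu; apply/negP => /eqP q1; have := odd_Prod _ _ _ u_transp qu.
    case: H => [-> | /negP one]; first by rewrite q1 odd_perm1.
    by case: one; rewrite -q1.
  by rewrite !neq1.
split=> [inv | [ou | [tree [x [y xy1]]]]].
- have [ou | ev] := boolP (odd (size u)); [by left | right].
  pose x := @Ordinal 3 0 isT; pose y := @Ordinal 3 1 isT; pose z := @Ordinal 3 2 isT.
  have U : uniq [:: x; y; z] by [].
  have two (a b c : 'I_3) : uniq [:: a; b; c] -> mult3 u a b <= 1 \/ mult3 u b c <= 1.
    move=> V; have [ab | ab] := leqP (mult3 u a b) 1; first by left.
    have [bc | bc] := leqP (mult3 u b c) 1; first by right.
    by case: (not_invariant_two_multiple _ _ _ _ V u_transp ev ab bc inv).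
  have par (a b c : 'I_3) : uniq [:: a; b; c] -> odd (mult3 u a b) -> odd (mult3 u b c) ->
      ~~ odd (mult3 u a c) -> mult3 u a c = 0.
    move=> V oa ob ec; apply/eqP; rewrite -leqn0 leqNgt; apply/negP => c0.
    exact: not_invariant_odd_odd_even V u_transp oa ob ec c0 inv.
  (* The support condition makes the other two multiplicities positive, and [two] bounds one of them
     by 1. *)
  have path (a b c : 'I_3) : uniq [:: a; b; c] -> mult3 u a c = 0 ->
      multitree (transp_multigraph u) /\ has_simple_multiedge (transp_multigraph u).
    move=> V ac0; have [ab bc ac] := uniq3P V.
    have ab0 : 0 < mult3 u a b.
      have := mult3_support _ _ _ _ (uniq3_swap V) u_transp u_supp.
      by rewrite ac0 addn0 mult3C.
    have bc0 : 0 < mult3 u b c.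
      have := mult3_support _ _ _ _ (uniq3_rot V) u_transp u_supp.
      by rewrite (mult3C u c a) ac0 addn0.
    split; first by apply: (multitree_path a b c); rewrite ?transp_mult3.
    case: (two _ _ _ V) => le1; [exists a, b | exists b, c]; rewrite transp_mult3 //; lia.
  move: ev; rewrite (size_mult3 U u_transp) => ev.
  have V := uniq3_swap U; have W := uniq3_rot U.
  have [c0 | c0] := posnP (mult3 u x z); first exact: path U c0.
  have [b0 | b0] := posnP (mult3 u y z); first exact: path V b0.
  have [a0 | a0] := posnP (mult3 u x y); first by apply: path W _; rewrite mult3C.
  (* With all three positive, [par] excludes two odd and one even. All even fails too, since by
     [two] some multiplicity is 1. *)
  have := par _ _ _ U; have := par _ _ _ V; have := par _ _ _ W; have := two _ _ _ U.
  have odd1 n : 0 < n -> n <= 1 -> odd n by case: n => [|[]].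
  rewrite (mult3C u z x) (mult3C u y x); move: ev; rewrite !oddD.
  case oa: (odd (mult3 u x y)); case ob: (odd (mult3 u y z));
  case oc: (odd (mult3 u x z)) => //= _ le1 pW pV pU.
  + by rewrite pU in c0.
  + by rewrite pV in b0.
  + by rewrite pW in a0.
  + by case: le1 => [/(odd1 _ a0) | /(odd1 _ b0)]; rewrite ?oa ?ob.
- by apply: invI; left.
- have [ou | ev] := boolP (odd (size u)); apply: invI; [by left | right].
  have xy : x != y by apply: contra_eqN xy1 => /eqP->; rewrite multiplicity_loop.
  have [z U] := third_point xy; have [_ yz xz] := uniq3P U.
  rewrite transp_mult3 // in xy1.
  (* Acyclicity removes one of the other two edges; [one_notin_Prod] is applied with the simple edge
     meeting the remaining one. *)
  have [b0 | b0] := posnP (mult3 u y z).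
    by apply: (one_notin_Prod y x z); rewrite // ?(uniq3_swap U) // mult3C.
  apply: (one_notin_Prod x y z) => //.
  by rewrite -transp_mult3 //; apply: (multitree_not_triangle x y z);
    rewrite ?transp_mult3 // xy1.
Qed.
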